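(* Let $k\in\mathbb{N}$ and $x\in\mathbb{R}$ with $|kx|<1$, and let $s\in\mathbb{C}$ with $\operatorname{Re}(s)>1$. Then $$\zeta(s)\,\zeta_{1,\mathrm{odd}}(x:k,s)=\frac{2^sLi_s(kx)-Li_s(k^2x^2)}{2^s-1},$$ where $\zeta$ is the Riemann zeta function.
   Context: For $k,n\in\mathbb{N}$ and $x\in\mathbb{R}$ define $L_k(x:n)=\frac{1}{n}\sum_{d\mid n}\mu\!\left(\frac{n}{d}\right)k^dx^d$, where $\mu$ is the Möbius function. Define $\zeta_{1,\mathrm{odd}}(x:k,s)=\sum_{n=1}^{\infty}\frac{L_k(x:2n-1)}{(2n-1)^{s-1}}$. The polylogarithm is $Li_s(z)=\sum_{n=1}^{\infty}\frac{z^n}{n^s}$. *)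

(* Defs.v *)
From Stdlib Require Import Reals.
From Coquelicot Require Import Coquelicot.
From mathcomp Require Import all_boot.

Set Implicit Arguments.
Unset Strict Implicit.
Unset Printing Implicit Defensive.

Local Open Scope R_scope.

(* The value at n = 0 is meaningless and never used. *)
Definition mobius (n : nat) : R :=
  if has (fun p => p ^ 2 %| n)%N (primes n) then 0
  else (-1) ^ size (primes n).

Definition L (k : nat) (x : R) (n : nat) : R :=
  / INR n *
  \big[Rplus/0]_(d <- divisors n) (mobius (n %/ d)%N * INR k ^ d * x ^ d).

Definition Cexp (z : C) : C :=
  (exp (Re z) * cos (Im z), exp (Re z) * sin (Im z)).

(* n ^ s = exp (s * ln n) with the real logarithm; only used for n >= 1. *)
Definition nat_cpow (n : nat) (s : C) : C := Cexp (s * RtoC (ln (INR n)))%C.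

Definition ex_Cseries (a : nat -> C) : Prop :=
  @ex_series R_AbsRing C_R_NormedModule a.

(* The sum of a complex series, real and imaginary parts separately; as with
   [Series], the value is meaningful only for a convergent series. *)
Definition CSeries (a : nat -> C) : C :=
  (Series (fun n => Re (a n)), Series (fun n => Im (a n))).

(* All series below start at n = 1 in the usual notation, so their n-th term
   in Coquelicot's indexing (from 0) is the usual term of index n.+1. *)

(* Dirichlet series of the Riemann zeta function: it is zeta on Re s > 1. *)
Definition zeta_term (s : C) (n : nat) : C := (/ nat_cpow n.+1 s)%C.
Definition zeta (s : C) : C := CSeries (zeta_term s).

Definition Li_term (s z : C) (n : nat) : C :=
  (Cpow z n.+1 / nat_cpow n.+1 s)%C.
Definition Li (s z : C) : C := CSeries (Li_term s z).

Definition zeta1odd_term (x : R) (k : nat) (s : C) (n : nat) : C :=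
  (RtoC (L k x (2 * n.+1 - 1)) / nat_cpow (2 * n.+1 - 1) (s - 1))%C.
Definition zeta1odd (x : R) (k : nat) (s : C) : C :=
  CSeries (zeta1odd_term x k s).

(* Main.v *)
(* With y = kx, m L_k(x:m) = sum_(d | m) mu(m/d) y^d is a Dirichlet convolution,
   so zeta_{1,odd} is the product of the Dirichlet series of y^n and of mu, both
   restricted to odd n.  Over odd n the series of mu is inverse to that of the
   constant 1, which is (1 - 2^-s) zeta(s), while the series of y^n is
   Li_s(y) - 2^-s Li_s(y^2); the claim follows.  Products of absolutely
   convergent Dirichlet series are handled by truncating to mn <= N. *)

Require Import Defs.
From Stdlib Require Import Reals Lra Lia.
From Coquelicot Require Import Coquelicot.
From HB Require Import structures.
From mathcomp Require Import all_boot.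

Set Implicit Arguments.
Unset Strict Implicit.
Unset Printing Implicit Defensive.

Local Open Scope R_scope.

(** * Monoid and distributivity laws for big operators over the reals and the complex numbers *)

Fact RplusA : associative Rplus. Proof. by move=> a b c; ring. Qed.
Fact Rplus0l : left_id 0 Rplus. Proof. by move=> a; ring. Qed.
HB.instance Definition _ :=
  Monoid.isComLaw.Build R 0 Rplus RplusA Rplus_comm Rplus0l.
Fact Rmult0l : left_zero 0 Rmult. Proof. by move=> a; ring. Qed.
Fact Rmult0r : right_zero 0 Rmult. Proof. by move=> a; ring. Qed.
HB.instance Definition _ := Monoid.isMulLaw.Build R 0 Rmult Rmult0l Rmult0r.
Fact RmultDl : left_distributive Rmult Rplus. Proof. by move=> a b c; ring. Qed.
Fact RmultDr : right_distributive Rmult Rplus.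
Proof. by move=> a b c; ring. Qed.
HB.instance Definition _ := Monoid.isAddLaw.Build R Rmult Rplus RmultDl RmultDr.

Fact CplusA : associative Cplus. Proof. by move=> a b c; ring. Qed.
Fact Cplus0l : left_id (RtoC 0) Cplus. Proof. by move=> a; ring. Qed.
HB.instance Definition _ :=
  Monoid.isComLaw.Build C (RtoC 0) Cplus CplusA Cplus_comm Cplus0l.
Fact Cmult0l : left_zero (RtoC 0) Cmult. Proof. by move=> a; ring. Qed.
Fact Cmult0r : right_zero (RtoC 0) Cmult. Proof. by move=> a; ring. Qed.
HB.instance Definition _ :=
  Monoid.isMulLaw.Build C (RtoC 0) Cmult Cmult0l Cmult0r.
Fact CmultDl : left_distributive Cmult Cplus. Proof. by move=> a b c; ring. Qed.
Fact CmultDr : right_distributive Cmult Cplus.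
Proof. by move=> a b c; ring. Qed.
HB.instance Definition _ := Monoid.isAddLaw.Build C Cmult Cplus CmultDl CmultDr.

(** * The Möbius function and its sum over divisors *)

Lemma mobius_bound n : Rabs (mobius n) <= 1.
Proof.
rewrite /mobius; case: ifP => _; first by rewrite Rabs_R0; lra.
rewrite -RPow_abs Rabs_Ropp Rabs_R1 pow1; lra.
Qed.

Lemma mobius_sq p n : prime p -> (0 < n)%N -> (p ^ 2 %| n)%N -> mobius n = 0.
Proof.
move=> pp n0 d2; rewrite /mobius ifT //; apply/hasP; exists p => //.
by rewrite mem_primes pp n0 (dvdn_trans _ d2) // dvdn_exp.
Qed.

(** The new prime [p] adds one sign. Squarefreeness is unaffected: [p ^ 2] does not divide [p * n],
    and for a prime [q] dividing [n], [q ^ 2] is coprime to [p]. *)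
Lemma mobius_primeM p n : prime p -> (0 < n)%N -> ~~ (p %| n)%N ->
  mobius (p * n) = - mobius n.
Proof.
move=> pp n0 pn; have p0 := prime_gt0 pp.
have npr : p \notin primes n by rewrite mem_primes pp n0.
have pe : primes (p * n) =i p :: primes n.
  by move=> q; rewrite primesM // primes_prime // inE in_cons.
have sz : size (primes (p * n)) = (size (primes n)).+1.
  apply: (@perm_size _ _ (p :: primes n)); apply: uniq_perm => //=.
    exact: primes_uniq.
  by rewrite npr primes_uniq.
have -> : mobius (p * n) = if has (fun q => q ^ 2 %| n)%N (primes n) then 0
  else (-1) ^ (size (primes n)).+1.
  rewrite /mobius sz (eq_has_r pe) /=.
  have -> : (p ^ 2 %| p * n)%N = false.
    by rewrite -mulnn dvdn_pmul2l // (negbTE pn).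
  rewrite /=; congr (if _ then _ else _); apply: eq_in_has => q.
  rewrite mem_primes => /and3P[pq _ qn]; rewrite Gauss_dvdr //.
  rewrite coprimeXl // prime_coprime // dvdn_prime2 //.
  by apply: contra pn => /eqP <-.
rewrite /mobius; case: ifP => _ /=; ring.
Qed.

(* Divisors d prime to p = pdiv n cancel against p * d; mobius vanishes on the
   multiples of p ^ 2. *)
Lemma sum_mobius_divisors n : (0 < n)%N ->
  \big[Rplus/0]_(d <- divisors n) mobius d = if n == 1%N then 1 else 0.
Proof.
move=> n0; case: eqVneq => [->|n1].
  by rewrite (_ : divisors 1 = [:: 1%N]) // big_seq1 /mobius /=.
have n2 : (1 < n)%N by case: n n0 n1 => [|[|]].
set p := pdiv n; have pp : prime p by apply: pdiv_prime.
have p0 := prime_gt0 pp; have pn : (p %| n)%N by apply: pdiv_dvd.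
rewrite (bigID (fun d => p %| d)%N) /= (bigID (fun d => p ^ 2 %| d)%N) /=.
rewrite big_seq_cond big1 ?Rplus_0_l; last first.
  move=> d /andP[]; rewrite -dvdn_divisors // => dn /andP[_ pd].
  by apply: mobius_sq pd => //; apply: dvdn_gt0 dn.
(* Multiplication by [p] is a bijection from the divisors prime to [p] onto those divisible by [p]
   exactly once; [p * e] still divides [n] because [p] and [e] are coprime divisors of [n]. *)
have -> : \big[Rplus/0]_(d <- divisors n | (p %| d)%N && ~~ (p ^ 2 %| d)%N)
    mobius d = \big[Rplus/0]_(d <- divisors n | ~~ (p %| d)%N) mobius (p * d).
  rewrite -big_filter -[RHS]big_filter -[RHS](big_map (muln p) xpredT mobius).
  apply: perm_big; apply: uniq_perm.
  - exact/filter_uniq/divisors_uniq.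
  - rewrite map_inj_uniq; first exact/filter_uniq/divisors_uniq.
    by move=> a b /eqP; rewrite eqn_pmul2l // => /eqP.
  move=> d; rewrite mem_filter -dvdn_divisors //; apply/andP/mapP.
    case=> /andP[/dvdnP[e ->] p2] dn; exists e; last by rewrite mulnC.
    rewrite mem_filter -dvdn_divisors // (dvdn_trans _ dn) ?dvdn_mulr // andbT.
    by apply: contra p2 => pe; rewrite -mulnn dvdn_pmul2r.
  case=> e; rewrite mem_filter -dvdn_divisors // => /andP[pe en] ->.
  rewrite dvdn_mulr // -mulnn dvdn_pmul2l // pe; split => //.
  by rewrite Gauss_dvd ?pn // prime_coprime.
have -> : \big[Rplus/0]_(d <- divisors n | ~~ (p %| d)%N) mobius (p * d)
   = \big[Rplus/0]_(d <- divisors n | ~~ (p %| d)%N) ((-1) * mobius d).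
  rewrite big_seq_cond [RHS]big_seq_cond; apply: eq_bigr => d /andP[].
  rewrite -dvdn_divisors // => dn pd.
  by rewrite mobius_primeM // ?(dvdn_gt0 _ dn) //; ring.
rewrite -big_distrr /=; ring.
Qed.

(** * Finite sums, Dirichlet convolution and the hyperbola estimate *)

Lemma Rsum_le (I : eqType) (r : seq I) (P : pred I) (f g : I -> R) :
  (forall i, i \in r -> P i -> f i <= g i) ->
  \big[Rplus/0]_(i <- r | P i) f i <= \big[Rplus/0]_(i <- r | P i) g i.
Proof.
move=> le_fg; rewrite big_seq_cond [X in _ <= X]big_seq_cond.
apply: (big_ind2 (fun a b => a <= b)); [lra|by move=> *; lra|].
by move=> i /andP[]; apply: le_fg.
Qed.

Lemma Cmod_sum_le (I : Type) (r : seq I) (P : pred I) (F : I -> C) :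
  Cmod (\big[Cplus/RtoC 0]_(i <- r | P i) F i)
  <= \big[Rplus/0]_(i <- r | P i) Cmod (F i).
Proof.
apply: (big_ind2 (fun z b => Cmod z <= b)); first by rewrite Cmod_0; lra.
  by move=> a b c d; have := Cmod_triangle a c; lra.
by move=> i _; lra.
Qed.

Definition dconv (F G : nat -> C) (n : nat) : C :=
  \big[Cplus/RtoC 0]_(d <- divisors n) (F d * G (n %/ d)%N)%C.

(** After exchanging the sums over [n] and its divisor [d], the multiples of [d] up to [N] are
    written [d * e], which turns the bound on [n] into [d * e <= N]. *)
Lemma sum_dconv F G N :
  \big[Cplus/RtoC 0]_(1 <= n < N.+1) dconv F G n =
  \big[Cplus/RtoC 0]_(1 <= m < N.+1)
    \big[Cplus/RtoC 0]_(1 <= e < N.+1 | (m * e <= N)%N) (F m * G e)%C.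
Proof.
pose H n := \big[Cplus/RtoC 0]_(1 <= d < N.+1 | (d %| n)%N)
  (F d * G (n %/ d)%N)%C.
transitivity (\big[Cplus/RtoC 0]_(1 <= n < N.+1) H n).
  rewrite [LHS]big_nat [RHS]big_nat; apply: eq_bigr => n /andP[n0 nN].
  rewrite /dconv /H -[RHS]big_filter; apply: perm_big; apply: uniq_perm.
  - exact: divisors_uniq.
  - exact/filter_uniq/iota_uniq.
  move=> d; rewrite mem_filter mem_index_iota -dvdn_divisors //.
  case dn: (d %| n)%N => //=.
  by rewrite (dvdn_gt0 n0 dn) (leq_ltn_trans (dvdn_leq n0 dn)).
rewrite /H (exchange_big_dep xpredT) //=.
rewrite [LHS]big_nat [RHS]big_nat; apply: eq_bigr => d /andP[d0 dN].
transitivity (\big[Cplus/RtoC 0]_(n <- [seq (d * e)%N | e <-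
    [seq e <- index_iota 1 N.+1 | (d * e <= N)%N]]) (F d * G (n %/ d)%N)%C).
  rewrite -big_filter; apply: perm_big; apply: uniq_perm.
  - exact/filter_uniq/iota_uniq.
  - rewrite map_inj_uniq; first exact/filter_uniq/iota_uniq.
    by move=> a b /eqP; rewrite eqn_pmul2l // => /eqP.
  move=> n; rewrite mem_filter mem_index_iota; apply/and3P/mapP.
    case=> /dvdnP[e ->]; rewrite muln_gt0 ltnS mulnC => /andP[e0 _] deN.
    exists e => //; rewrite mem_filter deN mem_index_iota e0 ltnS.
    by apply: leq_trans deN; apply: leq_pmull.
  case=> e; rewrite mem_filter mem_index_iota => /and3P[deN e0 _] ->.
  by rewrite dvdn_mulr // muln_gt0 d0 e0 ltnS deN.
by rewrite big_map big_filter; apply: eq_bigr => e _; rewrite mulKn.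
Qed.

(* The pairs (m, e) with m * e > N all lie outside the square [1, M]^2. *)
Lemma hyperbola_tail_le F G M N : (M * M <= N)%N ->
  Cmod (\big[Cplus/RtoC 0]_(1 <= n < N.+1) F n *
        \big[Cplus/RtoC 0]_(1 <= n < N.+1) G n -
        \big[Cplus/RtoC 0]_(1 <= n < N.+1) dconv F G n)%C
  <= \big[Rplus/0]_(1 <= n < N.+1) Cmod (F n) *
     \big[Rplus/0]_(1 <= n < N.+1) Cmod (G n) -
     \big[Rplus/0]_(1 <= n < M.+1) Cmod (F n) *
     \big[Rplus/0]_(1 <= n < M.+1) Cmod (G n).
Proof.
move=> MN; have leMN : (M <= N)%N.
  by case: M MN => // M; apply: leq_trans; apply: leq_pmulr.
pose h m e := Cmod (F m) * Cmod (G e).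
have h0 m e : 0 <= h m e by apply: Rmult_le_pos; apply: Cmod_ge_0.
have -> : (\big[Cplus/RtoC 0]_(1 <= n < N.+1) F n *
        \big[Cplus/RtoC 0]_(1 <= n < N.+1) G n -
        \big[Cplus/RtoC 0]_(1 <= n < N.+1) dconv F G n)%C
  = \big[Cplus/RtoC 0]_(1 <= m < N.+1)
    \big[Cplus/RtoC 0]_(1 <= e < N.+1 | ~~ (m * e <= N)%N) (F m * G e)%C.
  rewrite big_distrlr sum_dconv /=.
  under eq_bigr => m _ do rewrite (bigID (fun e => m * e <= N)%N) /=.
  rewrite big_split /=; ring.
rewrite !big_distrlr /=.
have -> : \big[Rplus/0]_(1 <= m < M.+1) \big[Rplus/0]_(1 <= e < M.+1) h m e
  = \big[Rplus/0]_(1 <= m < N.+1) \big[Rplus/0]_(1 <= e < N.+1)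
      (if (m <= M)%N && (e <= M)%N then h m e else 0).
  rewrite (big_nat_widen 1 M.+1 N.+1) //= big_mkcond.
  apply: eq_bigr => m _; rewrite ltnS; case: ifP => _ /=.
    by rewrite (big_nat_widen 1 M.+1 N.+1) //= big_mkcond.
  by rewrite big1.
(* This inequality holds term by term: [m <= M] and [e <= M] force [m * e <= M * M <= N], so at most
   one of the two left-hand terms is [h m e] and the other is 0. *)
suff : \big[Rplus/0]_(1 <= m < N.+1) \big[Rplus/0]_(1 <= e < N.+1)
         (if (m * e <= N)%N then 0 else h m e) +
       \big[Rplus/0]_(1 <= m < N.+1) \big[Rplus/0]_(1 <= e < N.+1)
         (if (m <= M)%N && (e <= M)%N then h m e else 0) <=
       \big[Rplus/0]_(1 <= m < N.+1) \big[Rplus/0]_(1 <= e < N.+1) h m e.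
  move=> le_sum; set z := \big[Cplus/RtoC 0]_(1 <= m < N.+1) _.
  suff : Cmod z <= \big[Rplus/0]_(1 <= m < N.+1) \big[Rplus/0]_(1 <= e < N.+1)
         (if (m * e <= N)%N then 0 else h m e).
    by move: le_sum; rewrite /h; lra.
  apply: Rle_trans (Cmod_sum_le _ _ _) _; apply: Rsum_le => m _ _.
  apply: Rle_trans (Cmod_sum_le _ _ _) _; rewrite big_mkcond /=.
  apply: Rsum_le => e _ _; rewrite if_neg; case: ifP => _; first lra.
  by rewrite Cmod_mult /h; lra.
rewrite -big_split /=; apply: Rsum_le => m _ _.
rewrite -big_split /=; apply: Rsum_le => e _ _.
have := h0 m e; case: ifP => meN; case: ifP => [/andP[mM eM]|_]; try lra.
by move: meN; rewrite (leq_trans _ MN) // leq_mul.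
Qed.

(** * Complex series and products of absolutely convergent Dirichlet series *)

Notation is_Cseries := (@is_series R_AbsRing C_R_NormedModule).

Lemma sum_n_Re_Im (a : nat -> C) n :
  @sum_n C_R_NormedModule a n =
  (sum_n (fun i => Re (a i)) n, sum_n (fun i => Im (a i)) n).
Proof.
elim: n => [|n IH]; first by rewrite !sum_O; case: (a 0%N).
by rewrite !sum_Sn IH.
Qed.

Lemma is_Cseries_Re_Im (a : nat -> C) (l : C) :
  is_Cseries a l <->
  is_series (fun n => Re (a n)) (Re l) /\ is_series (fun n => Im (a n)) (Im l).
Proof.
rewrite /is_series !filterlim_locally; split.
  move=> H; split=> eps; apply: filter_imp (H eps) => n.
    by rewrite sum_n_Re_Im => -[].
  by rewrite sum_n_Re_Im => -[].
move=> [H1 H2] eps; apply: filter_imp (filter_and _ _ (H1 eps) (H2 eps)) => n.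
by rewrite sum_n_Re_Im.
Qed.

Lemma is_Cseries_CSeries (a : nat -> C) (l : C) :
  is_Cseries a l -> CSeries a = l.
Proof.
move=> /is_Cseries_Re_Im[/is_series_unique HR /is_series_unique HI].
by rewrite /CSeries HR HI; case: l {HR HI}.
Qed.

(** Series in [C] are taken over the real normed module, whose scalars are real, so a complex factor
    is handled through real and imaginary parts. *)
Lemma is_Cseries_scal (c : C) (a : nat -> C) (l : C) :
  is_Cseries a l -> is_Cseries (fun n => c * a n)%C (c * l)%C.
Proof.
move=> /is_Cseries_Re_Im[HR HI]; apply/is_Cseries_Re_Im; split.
  apply: (is_series_ext (fun n => minus (scal (Re c) (Re (a n)))
                                        (scal (Im c) (Im (a n))))) => //.
  by apply: is_series_minus; apply: is_series_scal.
apply: (is_series_ext (fun n => plus (scal (Re c) (Im (a n)))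
                                     (scal (Im c) (Re (a n))))) => //.
by apply: is_series_plus; apply: is_series_scal.
Qed.

(** The partial sums of the paired series are a subsequence of those of [a]. With indices shifted by
    one, a pair holds the terms at an odd integer and at the even integer after it. *)
Lemma is_series_pairs (K : AbsRing) (V : NormedModule K) (a : nat -> V)
    (l : V) :
  is_series a l -> is_series (fun n => plus (a n.*2) (a n.*2.+1)) l.
Proof.
move=> Ha.
have E n : sum_n (fun n => plus (a n.*2) (a n.*2.+1)) n = sum_n a n.*2.+1.
  elim: n => [|n IH]; first by rewrite sum_Sn !sum_O.
  by rewrite sum_Sn IH doubleS (sum_Sn a n.*2.+2) (sum_Sn a n.*2.+1) plus_assoc.
rewrite /is_series; apply: filterlim_ext (fun n => esym (E n)) _.
apply: (filterlim_comp _ _ _ (fun n => n.*2.+1) (sum_n a)) Ha.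
move=> P [N HN]; exists N => n /leP Nn; apply: HN; apply/leP.
by apply: leq_trans Nn _; rewrite -addnn -addnS leq_addr.
Qed.

Lemma sum_n_bigR (f : nat -> R) n :
  sum_n (fun i => f i.+1) n = \big[Rplus/0]_(1 <= i < n.+2) f i.
Proof.
elim: n => [|n IH]; first by rewrite sum_O big_nat1.
by rewrite sum_Sn IH [RHS]big_nat_recr.
Qed.

Lemma sum_n_bigC (F : nat -> C) n :
  @sum_n C_R_NormedModule (fun i => F i.+1) n =
  \big[Cplus/RtoC 0]_(1 <= i < n.+2) F i.
Proof.
elim: n => [|n IH]; first by rewrite sum_O big_nat1.
by rewrite sum_Sn IH [RHS]big_nat_recr.
Qed.

Lemma filterlim_sqrt_pred :
  filterlim (fun n => (Nat.sqrt n.+1).-1) eventually eventually.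
Proof.
move=> P [N HN]; exists (N.+1 * N.+1)%N => n Hn; apply: HN.
have := Nat.sqrt_le_mono _ _ Hn; have := Nat.sqrt_le_mono _ _ (Nat.le_succ_diag_r n).
rewrite Nat.sqrt_square; lia.
Qed.

(** The hyperbola estimate bounds the error by [f n * g n - f (r n) * g (r n)]; both products tend
    to [a * b], so the error tends to 0. *)
Lemma dirichlet_product (F G : nat -> C) (A B : C) :
  ex_series (fun n => Cmod (F n.+1)) -> ex_series (fun n => Cmod (G n.+1)) ->
  is_Cseries (fun n => F n.+1) A -> is_Cseries (fun n => G n.+1) B ->
  is_Cseries (fun n => dconv F G n.+1) (A * B)%C.
Proof.
move=> [a Ha] [b Hb] HA HB.
pose f n := sum_n (fun n => Cmod (F n.+1)) n.
pose g n := sum_n (fun n => Cmod (G n.+1)) n.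
pose FF n := @sum_n C_R_NormedModule (fun n => F n.+1) n.
pose GG n := @sum_n C_R_NormedModule (fun n => G n.+1) n.
pose HH n := @sum_n C_R_NormedModule (fun n => dconv F G n.+1) n.
(* The partial sum at index [n] runs over 1 to [N = n.+1]; the inner square has side
   [M = Nat.sqrt N], whose partial sum has index [M.-1]. *)
pose r n := (Nat.sqrt n.+1).-1.
have bnd n : Cmod (FF n * GG n - HH n)%C <= f n * g n - f (r n) * g (r n).
  have fE m : f m = \big[Rplus/0]_(1 <= i < m.+2) Cmod (F i) := sum_n_bigR _ m.
  have gE m : g m = \big[Rplus/0]_(1 <= i < m.+2) Cmod (G i) := sum_n_bigR _ m.
  rewrite !fE !gE /FF /GG /HH !sum_n_bigC.
  apply: hyperbola_tail_le; rewrite prednK; last first.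
    by apply/leP; apply: (Nat.sqrt_le_mono 1 n.+1); lia.
  by apply/leP; apply: (proj1 (Nat.sqrt_specif n.+1)).
have lim0 : is_lim_seq (fun n => f n * g n - f (r n) * g (r n)) 0.
  have Lf : is_lim_seq f a by [].
  have Lg : is_lim_seq g b by [].
  rewrite -(Rminus_diag (a * b)).
  apply: is_lim_seq_minus'; apply: is_lim_seq_mult' => //;
    by apply: is_lim_seq_subseq => //; apply: filterlim_sqrt_pred.
have sq (u : nat -> R) : (forall n, Rabs (u n) <= Cmod (FF n * GG n - HH n)%C) ->
    is_lim_seq u 0.
  move=> Hu; have := proj1 (is_lim_seq_opp _ _) lim0; rewrite /= Ropp_0 => lim0N.
  apply: (is_lim_seq_le_le _ _ _ _ _ lim0N lim0) => n.
  have := Hu n; have := bnd n; have := Rle_abs (u n).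
  by have := Rle_abs (- u n); rewrite Rabs_Ropp; lra.
have split_lim (a0 : nat -> C) l : is_Cseries a0 l ->
    is_lim_seq (fun n => Re (@sum_n C_R_NormedModule a0 n)) (Re l) /\
    is_lim_seq (fun n => Im (@sum_n C_R_NormedModule a0 n)) (Im l).
  move=> /is_Cseries_Re_Im[H1 H2]; split.
    by apply: (is_lim_seq_ext (sum_n (fun i => Re (a0 i)))) => // n;
      rewrite sum_n_Re_Im.
  by apply: (is_lim_seq_ext (sum_n (fun i => Im (a0 i)))) => // n;
    rewrite sum_n_Re_Im.
have [AR AI] := split_lim _ _ HA; have [BR BI] := split_lim _ _ HB.
apply/is_Cseries_Re_Im; split.
  (* The partial sum of the convolution is the product of the partial sums minus the error; the
     [- 0] in the rewritten limit is the limit of that error. *)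
  change (is_lim_seq (sum_n (fun n => Re (dconv F G n.+1))) (Re (A * B)%C)).
  apply: (is_lim_seq_ext (fun n => Re (FF n) * Re (GG n) - Im (FF n) * Im (GG n)
            - Re (FF n * GG n - HH n)%C)) => [n|].
    by rewrite /HH sum_n_Re_Im /Re /Im /=; ring.
  rewrite (_ : Re (A * B)%C = Re A * Re B - Im A * Im B - 0);
    last by rewrite /Re /Im /=; ring.
  apply: is_lim_seq_minus'; last by apply: sq => n; apply: re_le_Cmod.
  by apply: is_lim_seq_minus'; apply: is_lim_seq_mult'.
change (is_lim_seq (sum_n (fun n => Im (dconv F G n.+1))) (Im (A * B)%C)).
apply: (is_lim_seq_ext (fun n => Re (FF n) * Im (GG n) + Im (FF n) * Re (GG n)
          - Im (FF n * GG n - HH n)%C)) => [n|].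
  by rewrite /HH sum_n_Re_Im /Re /Im /=; ring.
rewrite (_ : Im (A * B)%C = Re A * Im B + Im A * Re B - 0);
    last by rewrite /Re /Im /=; ring.
apply: is_lim_seq_minus'; last first.
  apply: sq => n; apply: Rle_trans (Rmax_Cmod _).
  exact: Rmax_r.
by apply: is_lim_seq_plus'; apply: is_lim_seq_mult'.
Qed.

(** * Complex powers of integers and convergence of the real p-series *)

Lemma Cexp_add (z w : C) : Cexp (z + w)%C = (Cexp z * Cexp w)%C.
Proof.
case: z => a b; case: w => c d.
by rewrite /Cexp /Cmult /Re /Im /= exp_plus cos_plus sin_plus; congr pair; ring.
Qed.

Lemma Cmod_Cexp (z : C) : Cmod (Cexp z) = exp (Re z).
Proof.
rewrite /Cmod /Cexp /=; set a := exp _; set b := Im z.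
have -> : a * cos b * (a * cos b * 1) + a * sin b * (a * sin b * 1) = a * a.
  transitivity (a * a * (Rsqr (sin b) + Rsqr (cos b))); first by rewrite /Rsqr; ring.
  by rewrite sin2_cos2; ring.
by apply: sqrt_square; apply: Rlt_le; apply: exp_pos.
Qed.

Lemma nat_cpowM m n s : (0 < m)%N -> (0 < n)%N ->
  nat_cpow (m * n) s = (nat_cpow m s * nat_cpow n s)%C.
Proof.
move=> /ltP/lt_0_INR m0 /ltP/lt_0_INR n0.
rewrite /nat_cpow -Cexp_add -multE mult_INR ln_mult // RtoC_plus.
by congr Cexp; ring.
Qed.

Lemma Cmod_nat_cpow n s : Cmod (nat_cpow n s) = exp (Re s * ln (INR n)).
Proof. by rewrite /nat_cpow Cmod_Cexp; congr exp; rewrite /Re /=; ring. Qed.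

Lemma nat_cpow_neq0 n s : nat_cpow n s <> RtoC 0.
Proof.
move=> E; have := Cmod_nat_cpow n s; rewrite E Cmod_0.
by have := exp_pos (Re s * ln (INR n)); lra.
Qed.

(** This is what absorbs the factor [/ INR n] of [L] into the exponent [s - 1]. *)
Lemma nat_cpow_pred n s : (0 < n)%N ->
  nat_cpow n s = (nat_cpow n (s - 1) * RtoC (INR n))%C.
Proof.
move=> /ltP/lt_0_INR n0.
have -> : RtoC (INR n) = Cexp (RtoC (ln (INR n))).
  by rewrite /Cexp /= exp_ln // cos_0 sin_0; congr pair; ring.
by rewrite /nat_cpow -Cexp_add; congr Cexp; ring.
Qed.

(* Since 2 q < 1 for q = 2^-sigma, bounding p(2j) + p(2j+1) by 2 q p(j) gives
   S(n) <= S(2n+2) <= 1 + 2 q S(n), hence a bound on the partial sums. *)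
Lemma ex_series_pseries sigma : 1 < sigma ->
  ex_series (fun n => exp (- sigma * ln (INR n.+1))).
Proof.
move=> sigma1; pose p n := exp (- sigma * ln (INR n)).
pose q := exp (- sigma * ln 2).
have p0 n : 0 < p n by apply: exp_pos.
have INR0 n : 0 < INR n.+1 by apply: lt_0_INR; lia.
have p_double n : p n.+1.*2 = q * p n.+1.
  have -> : p n.+1.*2 = exp (- sigma * ln (2 * INR n.+1)).
    by rewrite /p -mul2n -multE mult_INR.
  rewrite ln_mult //; last lra.
  by rewrite /p /q -exp_plus; congr exp; ring.
have p_succ n : p n.+2 <= p n.+1.
  apply/Rlt_le/exp_increasing; rewrite -!Ropp_mult_distr_l.
  apply/Ropp_lt_contravar/Rmult_lt_compat_l; first lra.
  by apply: ln_increasing => //; apply: lt_INR; lia.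
(* Writing 2 as [exp (ln 2)] gives [2 * q = exp ((1 - sigma) * ln 2)], with a negative exponent. *)
have q1 : 2 * q < 1.
  rewrite -[2]exp_ln; last lra.
  rewrite /q -exp_plus -exp_0; apply: exp_increasing.
  have : 0 < ln 2 by rewrite -ln_1; apply: ln_increasing; lra.
  by nra.
pose S n := sum_n (fun i => p i.+1) n.
have S_incr n : S n <= S n.+1.
  by rewrite {2}/S sum_Sn /plus /= -/(S n); have := p0 n.+2; lra.
have S_mono m n : (m <= n)%N -> S m <= S n.
  elim: n => [|n IH]; first by rewrite leqn0 => /eqP ->; lra.
  rewrite leq_eqVlt => /predU1P[->|/IH]; first lra.
  by have := S_incr n; lra.
have S_double n : S n.*2.+2 <= 1 + 2 * q * S n.
  elim: n => [|n IH].
    have -> : S 0.*2.+2 = p 1%N + p 2%N + p 3%N by rewrite /S !sum_Sn sum_O.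
    have -> : S 0%N = p 1%N by rewrite /S sum_O.
    have -> : p 2%N = q * p 1%N := p_double 0%N.
    have p1 : p 1%N = 1 by rewrite /p /= ln_1 Rmult_0_r exp_0.
    by have : p 3%N <= q * p 1%N;
      [rewrite -(p_double 0%N); apply: p_succ | rewrite p1; lra].
  have -> : S n.+1.*2.+2 = S n.*2.+2 + p n.+2.*2 + p n.+2.*2.+1.
    by rewrite /S !doubleS (sum_Sn _ n.*2.+3) (sum_Sn _ n.*2.+2).
  have -> : S n.+1 = S n + p n.+2 by rewrite {1}/S sum_Sn.
  have := p_double n.+1; have := p_succ n.+1.*2.+1; rewrite -doubleS; lra.
have S_bound n : S n <= / (1 - 2 * q).
  have h : S n <= 1 + 2 * q * S n.
    apply: Rle_trans (S_double n); apply: S_mono.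
    by rewrite -addnn -addnS -addnS leq_addr.
  apply: (Rmult_le_reg_l (1 - 2 * q)); first lra.
  rewrite Rinv_r; lra.
have [l Hl] := ex_finite_lim_seq_incr S _ S_incr S_bound.
by exists l.
Qed.

(** * Dirichlet series with bounded real coefficients *)

Definition dterm (s : C) (f : nat -> R) (n : nat) : C :=
  (RtoC (f n) / nat_cpow n s)%C.

Definition dseries s f l := is_Cseries (fun n => dterm s f n.+1) l.

Definition rconv (f g : nat -> R) (n : nat) : R :=
  \big[Rplus/0]_(d <- divisors n) (f d * g (n %/ d)%N).

Definition oddf (f : nat -> R) (n : nat) : R := if odd n then f n else 0.

Lemma dseries_Cmod s f : 1 < Re s -> (forall n, Rabs (f n) <= 1) ->
  ex_series (fun n => Cmod (dterm s f n.+1)).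
Proof.
move=> s1 f1; apply: (@ex_series_le R_AbsRing R_CompleteNormedModule);
  last exact: ex_series_pseries s1.
move=> n; rewrite /norm /= /abs /= Rabs_pos_eq; last exact: Cmod_ge_0.
rewrite /dterm /Cdiv Cmod_mult Cmod_inv; last exact: nat_cpow_neq0.
rewrite Cmod_nat_cpow Cmod_R -exp_Ropp.
rewrite Ropp_mult_distr_l -[X in _ <= X]Rmult_1_l.
by apply: Rmult_le_compat_r => //; apply/Rlt_le/exp_pos.
Qed.

Lemma dseries_ex s f : 1 < Re s -> (forall n, Rabs (f n) <= 1) ->
  exists l, dseries s f l.
Proof.
move=> s1 f1; apply: (@ex_series_le R_AbsRing C_R_CompleteNormedModule _ _ _
  (dseries_Cmod s1 f1)) => n.
by rewrite Cmod_norm; apply: Rle_refl.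
Qed.

Lemma dseries_unique s f a b : dseries s f a -> dseries s f b -> a = b.
Proof. by move=> /is_Cseries_CSeries <- /is_Cseries_CSeries <-. Qed.

(** Since [nat_cpow] is multiplicative, the denominators at [d] and [n %/ d] combine to the one at
    [n], leaving only the real coefficients to convolve. *)
Lemma dconv_dterm s f g n : (0 < n)%N ->
  dconv (dterm s f) (dterm s g) n = dterm s (rconv f g) n.
Proof.
move=> n0; rewrite /dconv /dterm /rconv.
rewrite (big_morph RtoC RtoC_plus (erefl (RtoC 0))) /Cdiv big_distrl /=.
rewrite big_seq [RHS]big_seq; apply: eq_bigr => d; rewrite -dvdn_divisors // => dn.
have d0 := dvdn_gt0 n0 dn.
have -> : nat_cpow n s = (nat_cpow (n %/ d) s * nat_cpow d s)%C.
  have q0 : (0 < n %/ d)%N by rewrite divn_gt0 // dvdn_leq.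
  by rewrite -(nat_cpowM s q0 d0) (divnK dn).
rewrite RtoC_mult.
by field; split; apply: nat_cpow_neq0.
Qed.

Lemma dseries_mul s f g A B : 1 < Re s ->
  (forall n, Rabs (f n) <= 1) -> (forall n, Rabs (g n) <= 1) ->
  dseries s f A -> dseries s g B -> dseries s (rconv f g) (A * B)%C.
Proof.
move=> s1 f1 g1 HA HB.
have := dirichlet_product (dseries_Cmod s1 f1) (dseries_Cmod s1 g1) HA HB.
by apply: is_series_ext => n; apply: dconv_dterm.
Qed.

Lemma dterm0 s f n : f n = 0 -> dterm s f n = RtoC 0.
Proof. by move=> f0; rewrite /dterm f0 /Cdiv Cmult_0_l. Qed.

Lemma eq_dseries s f g l : (forall n, (0 < n)%N -> f n = g n) ->
  dseries s f l -> dseries s g l.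
Proof. by move=> fg; apply: is_series_ext => n; rewrite /dterm fg. Qed.

Lemma dseries_one s : dseries s (fun n => if n == 1%N then 1 else 0) (RtoC 1).
Proof.
have E n : @sum_n C_R_NormedModule
    (fun n => dterm s (fun n => if n == 1%N then 1 else 0) n.+1) n = RtoC 1.
  elim: n => [|n IH].
    rewrite sum_O /dterm /= /nat_cpow /= ln_1 Cmult_0_r /Cexp /= exp_0 cos_0 sin_0.
    rewrite Rmult_1_l Rmult_0_r -/(RtoC 1); field.
  by rewrite sum_Sn IH dterm0 // /plus /= /prod_plus /plus /= !Rplus_0_r.
apply: filterlim_ext (fun n => esym (E n)) _; exact: filterlim_const.
Qed.

(** * Restriction to odd indices *)

Lemma dseries_oddf_odd s f l : dseries s (oddf f) l ->
  is_Cseries (fun n => dterm s f n.*2.+1) l.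
Proof.
move/is_series_pairs; apply: is_series_ext => n.
rewrite [X in plus _ X]dterm0; last by rewrite /oddf /= odd_double.
by rewrite (plus_zero_r (G := C_R_NormedModule)) /dterm /oddf /= odd_double.
Qed.

(** The even-indexed terms of the series of [f] form the series of [g] divided by [nat_cpow 2 s].
    This serves for constant 1 with itself, and for the powers of [y] with those of [y ^ 2]. *)
Lemma dseries_oddf s f g A B : 1 < Re s -> (forall n, Rabs (f n) <= 1) ->
  (forall n, f n.*2 = g n) -> dseries s f A -> dseries s g B ->
  dseries s (oddf f) (A - B / nat_cpow 2 s)%C.
Proof.
move=> s1 f1 fg HA HB.
have of1 n : Rabs (oddf f n) <= 1.
  by rewrite /oddf; case: ifP => // _; rewrite Rabs_R0; lra.
(* Convergence comes from the coefficient bound alone; the limit [l] is then identified by summing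
   the odd-indexed terms in a second way. *)
have [l Hl] := dseries_ex s1 of1.
suff -> : (A - B / nat_cpow 2 s)%C = l by [].
rewrite -(is_Cseries_CSeries (dseries_oddf_odd Hl)).
apply/esym/is_Cseries_CSeries.
have -> : (A - B / nat_cpow 2 s)%C =
    @minus C_R_NormedModule A (/ nat_cpow 2 s * B)%C.
  by rewrite /Cdiv (Cmult_comm B).
(* From each pair of consecutive terms of [f], the matching scaled term of [g] removes the
   even-indexed one. *)
apply: is_series_ext (is_series_minus _ _ _ _ (is_series_pairs HA)
  (is_Cseries_scal (c := (/ nat_cpow 2 s)%C) HB)) => n.
have -> : dterm s f n.*2.+2 = (/ nat_cpow 2 s * dterm s g n.+1)%C.
  rewrite /dterm -doubleS fg -mul2n nat_cpowM //.
  by field; split; apply: nat_cpow_neq0.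
rewrite /minus -(plus_assoc (G := C_R_NormedModule)).
by rewrite (plus_opp_r (G := C_R_NormedModule)) plus_zero_r.
Qed.

(** If [n] is odd, so are [d] and [n %/ d]; if [n] is even, one of them is even and the product
    vanishes. *)
Lemma rconv_oddf f g n : (0 < n)%N ->
  rconv (oddf f) (oddf g) n = oddf (rconv f g) n.
Proof.
move=> n0; rewrite /rconv /oddf big_seq; case: ifP => on.
  rewrite [RHS]big_seq; apply: eq_bigr => d.
  rewrite -dvdn_divisors // => dn.
  by rewrite (dvdn_odd dn on) (dvdn_odd (dvdn_div dn) on).
rewrite big1 // => d; rewrite -dvdn_divisors // => dn.
move: on; rewrite -{1}(divnK dn) oddM andbC.
by case: (odd d) => /= [->|_]; ring.
Qed.

(** * Coefficients of the series in the theorem, and the identity itself *)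

Lemma rconv_mobius_one n : (0 < n)%N ->
  rconv mobius (fun=> 1) n = if n == 1%N then 1 else 0.
Proof.
move=> n0; rewrite -sum_mobius_divisors // /rconv.
by apply: eq_bigr => d _; ring.
Qed.

Lemma L_dterm k x s n : (0 < n)%N ->
  (RtoC (L k x n) / nat_cpow n (s - 1))%C =
  dterm s (rconv (pow (INR k * x)) mobius) n.
Proof.
move=> n0; have n0R : INR n <> 0 by apply: not_0_INR; apply/eqP; rewrite -lt0n.
have n0C : RtoC (INR n) <> RtoC 0 by case.
rewrite /dterm (nat_cpow_pred s n0) /L RtoC_mult RtoC_inv //.
have -> : \big[Rplus/0]_(d <- divisors n) (mobius (n %/ d)%N * INR k ^ d * x ^ d)
  = rconv (pow (INR k * x)) mobius n.
  by apply: eq_bigr => d _; rewrite Rpow_mult_distr; ring.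
by field; split => //; apply: nat_cpow_neq0.
Qed.

Lemma Li_term_dterm s y n : Li_term s (RtoC y) n = dterm s (pow y) n.+1.
Proof. by rewrite /Li_term /dterm RtoC_pow. Qed.

Lemma zeta_term_dterm s n : zeta_term s n = dterm s (fun=> 1) n.+1.
Proof. by rewrite /zeta_term /dterm /Cdiv Cmult_1_l. Qed.

Lemma zeta1odd_term_dterm x k s n : zeta1odd_term x k s n =
  dterm s (rconv (pow (INR k * x)) mobius) n.*2.+1.
Proof.
have N : (2 * n.+1 - 1)%coq_nat = n.*2.+1 by rewrite -mul2n -multE; lia.
by rewrite /zeta1odd_term (_ : (2 * n.+1 - 1)%N = n.*2.+1) // L_dterm.
Qed.

Theorem theorem4 (k : nat) (x : R) (s : C)
    (hx : (Rabs (INR k * x) < 1)%R) (hs : (1 < Re s)%R) :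
  ex_Cseries (zeta_term s) /\
  ex_Cseries (zeta1odd_term x k s) /\
  ex_Cseries (Li_term s (RtoC (INR k * x))) /\
  ex_Cseries (Li_term s (RtoC (INR k ^ 2 * x ^ 2))) /\
  (zeta s * zeta1odd x k s =
   (nat_cpow 2 s * Li s (RtoC (INR k * x)) - Li s (RtoC (INR k ^ 2 * x ^ 2)))
   / (nat_cpow 2 s - 1))%C.
Proof.
set y := INR k * x in hx *.
have -> : INR k ^ 2 * x ^ 2 = y ^ 2 by rewrite /y Rpow_mult_distr.
have pow_le1 z n : Rabs z <= 1 -> Rabs (z ^ n) <= 1.
  by move=> z1; rewrite -RPow_abs -(pow1 n); apply: pow_incr; split => //;
    apply: Rabs_pos.
have y1 n : Rabs (y ^ n) <= 1 by apply/pow_le1/Rlt_le.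
have y2 n : Rabs ((y ^ 2) ^ n) <= 1 by apply: pow_le1.
have one1 (n : nat) : Rabs 1 <= 1 by rewrite Rabs_R1; lra.
have odd1 f : (forall n, Rabs (f n) <= 1) -> forall n, Rabs (oddf f n) <= 1.
  by move=> f1 n; rewrite /oddf; case: ifP => // _; rewrite Rabs_R0; lra.
have [Z HZ] := dseries_ex hs one1.
have [A HA] := dseries_ex hs y1.
have [B HB] := dseries_ex hs y2.
have [M HM] := dseries_ex hs (odd1 _ mobius_bound).
have HZo := dseries_oddf hs one1 (fun=> erefl) HZ HZ.
have HAo : dseries s (oddf (pow y)) (A - B / nat_cpow 2 s)%C.
  by apply: dseries_oddf HA HB => // n; rewrite -mul2n pow_mult.
(* Möbius inversion survives the restriction to odd integers because the convolution identity is
   concentrated at 1, which is odd. *)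
have MZ : (M * (Z - Z / nat_cpow 2 s))%C = RtoC 1.
  have H := dseries_mul hs (odd1 _ mobius_bound) (odd1 _ one1) HM HZo.
  apply: dseries_unique H (eq_dseries _ (dseries_one s)) => n n0.
  rewrite rconv_oddf // /oddf rconv_mobius_one //.
  by case: n n0 => [|[|n]] //= _; case: ifP.
(* The product series has coefficients [oddf (rconv (pow y) mobius)]; dropping its zero even terms
   leaves exactly the series over [n.*2.+1]. *)
have HO : is_Cseries (zeta1odd_term x k s) ((A - B / nat_cpow 2 s) * M)%C.
  apply: is_series_ext (dseries_oddf_odd (f := rconv (pow y) mobius) _) => [n|].
    by rewrite zeta1odd_term_dterm.
  apply: eq_dseries (dseries_mul hs (odd1 _ y1) (odd1 _ mobius_bound) HAo HM).
  by move=> n n0; rewrite rconv_oddf.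
have {}HZ : is_Cseries (zeta_term s) Z.
  by apply: is_series_ext HZ => n; rewrite zeta_term_dterm.
have {}HA : is_Cseries (Li_term s (RtoC y)) A.
  by apply: is_series_ext HA => n; rewrite Li_term_dterm.
have {}HB : is_Cseries (Li_term s (RtoC (y ^ 2))) B.
  by apply: is_series_ext HB => n; rewrite Li_term_dterm.
split; first by exists Z.
split; first by exists ((A - B / nat_cpow 2 s) * M)%C.
split; first by exists A.
split; first by exists B.
rewrite /zeta /zeta1odd /Li (is_Cseries_CSeries HZ) (is_Cseries_CSeries HO).
rewrite (is_Cseries_CSeries HA) (is_Cseries_CSeries HB).
have w0 : nat_cpow 2 s <> RtoC 0 by apply: nat_cpow_neq0.
(* The modulus of [nat_cpow 2 s] is [exp (Re s * ln 2)], which differs from 1 as [Re s] and [ln 2]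
   are positive. *)
have w1 : (nat_cpow 2 s - 1)%C <> RtoC 0.
  move=> E; have {}E : nat_cpow 2 s = RtoC 1.
    transitivity (nat_cpow 2 s - 1 + 1)%C; first by ring.
    by rewrite E; ring.
  have := Cmod_nat_cpow 2 s; rewrite E Cmod_1 -exp_0 => /exp_inv.
  have : 0 < ln (INR 2) by rewrite -ln_1; apply: ln_increasing => /=; lra.
  by nra.
move: MZ; set w := nat_cpow 2 s in w0 w1 *; set a := (A - _)%C => MZ.
(* Since [Z - Z / w = Z * (w - 1) / w], the factor [w / (w - 1)] compensates, and [MZ] then
   eliminates both [M] and [Z]. *)
have -> : (Z * (a * M))%C = (a * (M * (Z - Z / w)) * (w / (w - 1)))%C.
  by field.
by rewrite MZ /a; field.
Qed.
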